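(* Let $k \geq 2$ be an even integer, let $m$ be a positive integer, and let $q$ be a prime power such that $q \equiv k+1 \pmod{2k}$. If $\mathcal{K}_m(G_k(q))=0$, then $q<R_{\frac{k}{2}}(m)$.
   Context: $\mathbb{F}_q$ is the finite field with $q$ elements and $S_k \subset \mathbb{F}_q^*$ is the subgroup of nonzero $k$-th powers (of order $\frac{q-1}{k}$). The $k$-th power Paley digraph $G_k(q)$ has vertex set $\mathbb{F}_q$, and $a \to b$ is an edge if and only if $b-a \in S_k$ (the condition on $q$ gives $-1 \notin S_k$, so there is at most one edge between any two vertices). For a digraph $G$, $\mathcal{K}_m(G)$ is the number of transitive subtournaments of order $m$ contained in $G$; a tournament of order $m$ is transitive if its vertices can be listed $a_1,\dots,a_m$ with $a_i \to a_j$ for all $i<j$. The multicolor directed Ramsey number $R(n_1,n_2,\dots,n_t)$ is the smallest integer $N$ such that any tournament of order $N$ whose edges have been colored with $t$ colors contains, for some $1 \leq i \leq t$, a transitive subtournament of order $n_i$ all of whose edges have color $i$ (these numbers exist). $R_t(n)$ denotes $R(n,n,\dots,n)$ with $t$ arguments; for $t=1$ this is the usual directed Ramsey number $R(n)$ for tournaments. *)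

(* Defs.v *)
From mathcomp Require Import all_boot all_algebra.
From mathcomp Require Import boolp.

Set Implicit Arguments.
Unset Strict Implicit.
Unset Printing Implicit Defensive.

Import GRing.Theory.

Local Open Scope nat_scope.

Section Digraphs.
Variable V : finType.

(* A digraph on V is a relation e : rel V, and e x y means x -> y. *)

(* The restriction of e to A is a tournament on the vertex set A. *)
Definition tournament (A : {set V}) (e : rel V) : bool :=
  [forall x in A, ~~ e x x] &&
  [forall x in A, forall y in A, (x != y) ==> (e x y (+) e y x)].

(* s is a listing a_1, ..., a_m of A, and [pairwise] says that a_i -> a_j
   whenever i < j. *)
Definition transitive_tournament (A : {set V}) (e : rel V) : bool :=
  tournament A e &&
  [exists s : #|A|.-tuple V, ([set x in s] == A) && pairwise e s].

(* A subdigraph of e is a pair H of a vertex set H.1 and an arc set H.2; it need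
   not be induced. *)
Definition transitive_subtournament (e : rel V) (m : nat)
    (H : {set V} * {set V * V}) : bool :=
  [&& #|H.1| == m,
      H.2 \subset setX H.1 H.1,
      [forall p in H.2, e p.1 p.2] &
      transitive_tournament H.1 [rel x y | (x, y) \in H.2]].

Definition num_transitive (m : nat) (e : rel V) : nat :=
  #|[set H | transitive_subtournament e m H]|.

End Digraphs.

Definition kth_powers (F : finFieldType) (k : nat) : {set F} :=
  [set (x ^+ k)%R | x in [set~ 0%R]].

Definition paley (F : finFieldType) (k : nat) : rel F :=
  fun a b => (b - a)%R \in kth_powers F k.

(* A colouring is a function on the subtype of arcs. *)
Definition ramsey_property (t : nat) (n : 'I_t -> nat) (N : nat) : Prop :=
  forall (V : finType) (e : rel V) (c : {p : V * V | e p.1 p.2} -> 'I_t),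
    #|V| = N -> tournament [set: V] e ->
    exists (i : 'I_t) (H : {set V} * {set V * V}),
      transitive_subtournament e (n i) H /\
      forall p : {p : V * V | e p.1 p.2}, val p \in H.2 -> c p = i.

Lemma tournament_irr (V : finType) (e : rel V) x :
  tournament [set: V] e -> e x x = false.
Proof. by case/andP=> /forall_inP/(_ x (in_setT _))/negbTE. Qed.

Lemma tournament_total (V : finType) (e : rel V) x y :
  tournament [set: V] e -> x != y -> e x y (+) e y x.
Proof.
case/andP=> _ /forall_inP/(_ x (in_setT _))/forall_inP/(_ y (in_setT _)).
by move/implyP.
Qed.

Lemma ramsey_listing (t : nat) (s : nat) : 0 < t -> exists N, forall (V : finType)
    (e : rel V) (c : V -> V -> 'I_t) (n : 'I_t -> nat) (A : {set V}),
  tournament [set: V] e -> \sum_i n i <= s -> N <= #|A| ->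
  exists (i : 'I_t) (l : seq V), [/\ size l = n i, {subset l <= A} &
    pairwise [rel x y | e x y && (c x y == i)] l].
Proof.
move=> t_gt0; elim: s => [|s [N IH]].
  exists 0 => V e c n A _ + _; rewrite leqn0 sum_nat_eq0 => /forallP n0.
  by exists (Ordinal t_gt0), [::]; split=> //; apply/esym/eqP/(n0 (Ordinal _)).
exists (2 * t * N).+2 => V e c n A te ns cA.
have [/existsP[i /eqP ni]|/existsPn n_neq0] := boolP [exists i, n i == 0].
  by exists i, [::].
have /card_gt0P[v vA] : 0 < #|A| by apply: leq_trans cA.
pose f x : bool * 'I_t := (e v x, if e v x then c v x else c x v).
pose B b := [set x in A :\ v | f x == b].
have [b cB] : exists b, N < #|B b|.
  apply/existsP; apply: contraT => /existsPn sB.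
  have : #|A :\ v| <= 2 * t * N.
    have -> : #|A :\ v| = \sum_b #|B b|.
      rewrite -sum1_card (partition_big f predT) //=; apply: eq_bigr => b _.
      by rewrite -sum1_card; apply: eq_bigl => x; rewrite !inE.
    apply: (@leq_trans (\sum_(b : bool * 'I_t) N)).
      by apply: leq_sum => b _; rewrite leqNgt sB.
    by rewrite sum_nat_const card_prod card_bool card_ord.
  by move: cA; rewrite (cardsD1 v) vA add1n ltnS => /leq_trans/[apply]; rewrite ltnn.
case: b cB => d i cB.
have ni : 0 < n i by rewrite lt0n.
pose n' j := if j == i then (n i).-1 else n j.
have n's : \sum_j n' j <= s.
  rewrite -ltnS; apply: leq_trans ns.
  rewrite (bigD1 i) //= [X in _ < X](bigD1 i) //= {1}/n' eqxx -addSn prednK //.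
  by rewrite leq_add2l leq_sum // => j /negbTE ji; rewrite /n' ji.
have [j [l [sl lB pl]]] := IH V e c n' _ te n's (ltnW cB).
have lA : {subset l <= A}.
  by move=> x /lB; rewrite !inE => /andP[/andP[]].
move: sl; rewrite /n'; have [ji|_] := eqVneq j i => sl; last by exists j, l.
rewrite {j}ji in sl pl; case: d cB lB => _ lB.
  exists i, (v :: l); split=> /=; first by rewrite sl prednK.
    by move=> x; rewrite inE => /predU1P[->|/lA].
  rewrite pl andbT; apply/allP => x /lB; rewrite !inE => /andP[_] /=.
  by rewrite /f => /eqP[-> ->]; rewrite eqxx.
exists i, (rcons l v); split=> /=; first by rewrite size_rcons sl prednK.
  by move=> x; rewrite mem_rcons inE => /predU1P[->|/lA].
rewrite pairwise_rcons pl andbT; apply/allP => x /lB; rewrite !inE /=.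
case/andP=> /andP[xv _] /eqP; rewrite /f => -[evx].
rewrite evx => ->; rewrite eqxx andbT.
by have := tournament_total te xv; rewrite evx addbF.
Qed.

Lemma ramsey_exists (t : nat) (n : 'I_t -> nat) :
  exists N, `[< ramsey_property n N >].
Proof.
have [t0|t_gt0] := posnP t.
  exists 2; apply/asboolP => V e c cV te.
  have [x [y [_ _ xy]]] : exists x y : V, [/\ x \in [set: V], y \in [set: V] & x != y].
    by apply/card_gt1P; rewrite cardsT cV.
  suff [p] : exists p : {p : V * V | e p.1 p.2}, True.
    by move: (c p); rewrite {1}t0 => -[].
  have := tournament_total te xy; have [exy _|_ /= eyx] := boolP (e x y).
    by exists (exist _ (x, y) exy).
  by exists (exist _ (y, x) eyx).
have [N HN] := ramsey_listing (\sum_i n i) t_gt0.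
exists N; apply/asboolP => V e c cV te.
pose c' x y : 'I_t := if insub (x, y) is Some p then c p else Ordinal t_gt0.
have [||i [l [sl _ pl]]] := HN V e c' n [set: V] te; first exact: leqnn.
  by rewrite cardsT cV.
have pe : pairwise e l by apply: sub_pairwise pl => x y /andP[].
have ul : uniq l.
  rewrite uniq_pairwise; apply: sub_pairwise pe => x y /=.
  by apply: contraTneq => ->; rewrite (tournament_irr _ te).
pose A := [set x in l].
have cA : #|A| = size l by rewrite cardsE; apply/card_uniqP.
exists i, (A, [set p in setX A A | e p.1 p.2]); split; last first.
  case=> -[x y] /= exy; rewrite !inE /= => /andP[/andP[xl yl] _].
  suff : c' x y == i by rewrite /c' insubT => /eqP.
  have := pl => /(pairwiseP x) P.
  case: (ltngtP (index x l) (index y l)) => [xy|yx|xy].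
  - have := P (index x l) (index y l); rewrite !inE !index_mem !nth_index //.
    by move=> /(_ xl yl xy)/andP[].
  - have := P (index y l) (index x l); rewrite !inE !index_mem !nth_index //.
    move=> /(_ yl xl yx)/andP[eyx _]; have xny : x != y.
      by apply: contraTneq yx => ->; rewrite ltnn.
    by have := tournament_total te xny; rewrite exy eyx.
  - move: exy; rewrite -(nth_index x xl) xy (nth_index x yl).
    by rewrite (tournament_irr _ te).
rewrite /transitive_subtournament /= cA sl eqxx /=; apply/and3P; split.
- by apply/fintype.subsetP => p; rewrite inE => /andP[].
- by apply/forall_inP => p; rewrite inE => /andP[].
apply/andP; split; first (apply/andP; split).
- by apply/forall_inP => x _; rewrite /= !inE (tournament_irr _ te) andbF.
- apply/forall_inP => x xA; apply/forall_inP => y yA; apply/implyP => xy.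
  by move: xA yA; rewrite /= !inE => -> ->; exact: tournament_total te xy.
apply/existsP; have sA : size l == #|A| by rewrite cA.
exists (Tuple sA); apply/andP; split; first by apply/eqP/setP => x; rewrite !inE.
apply: (@sub_in_pairwise _ [in l] e) pe => [x y /= xl yl exy|].
  by rewrite !inE /= xl yl.
by apply/allP.
Qed.

Definition ramsey (t : nat) (n : 'I_t -> nat) : nat := ex_minn (ramsey_exists n).

Definition ramsey_diag (t n : nat) : nat := ramsey (fun _ : 'I_t => n).

(* Main.v *)
Require Import Defs.
From mathcomp Require Import all_boot all_algebra.
From mathcomp Require Import boolp zify cyclic finfield.

(** The field F itself carries a coloured tournament without monochromatic
    transitive subtournament of order m.  Let g be a generator of the
    multiplicative group of F, of order n = q - 1, and write t for k/2.  The
    congruence on q says that n is an odd multiple of k, so that -1 = g ^ (n/2)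
    lies in the coset g ^ t S_k ([log_opp]).  Hence, among the k cosets g ^ i S_k,
    negation exchanges those with i < t and those with t <= i < k: the relation
    "b - a lies in g ^ i S_k for some i < t" is a tournament on F
    ([coset_tournament]), and i is a colour among t.  The map x |-> x / g ^ i
    sends the arcs of colour i to arcs of the Paley digraph, so a monochromatic
    transitive subtournament of order m would give one in the Paley digraph
    ([transitive_subtournament_image]).  Finally, a coloured tournament of order q
    without monochromatic transitive subtournament forces q < R, because the same
    holds for its restrictions to subsets of F ([ramsey_gt]). *)

Set Implicit Arguments.
Unset Strict Implicit.
Unset Printing Implicit Defensive.

Import GRing.Theory.

Local Open Scope nat_scope.

Lemma transitive_subtournament_image (V W : finType) (f : V -> W)
    (e : rel V) (e' : rel W) (m : nat) (H : {set V} * {set V * V}) :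
  injective f -> transitive_subtournament e m H ->
  (forall p, p \in H.2 -> e' (f p.1) (f p.2)) ->
  transitive_subtournament e' m
    (f @: H.1, [set (f p.1, f p.2) | p in H.2]).
Proof.
case: H => A E /= f_inj /and4P[/= /eqP cA /fintype.subsetP sE _].
case/andP=> /andP[/forall_inP irr /forall_inP tot].
case/existsP=> s /andP[/eqP sA ps] E_e'.
pose f2 (p : V * V) := (f p.1, f p.2).
have f2_inj : injective f2 by move=> [x y] [z w] [/f_inj -> /f_inj ->].
have memE x y : ((f x, f y) \in f2 @: E) = ((x, y) \in E).
  exact: (mem_imset E (x, y) f2_inj).
apply/and4P; split=> /=.
- by rewrite card_imset // cA.
- apply/fintype.subsetP=> _ /imsetP[p /sE + ->]; rewrite !inE /= => /andP[p1 p2].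
  by rewrite !imset_f.
- by apply/forall_inP=> _ /imsetP[p pE ->]; apply: E_e'.
apply/andP; split; first (apply/andP; split).
- by apply/forall_inP=> _ /imsetP[x xA ->]; rewrite /= memE; apply: irr.
- apply/forall_inP=> _ /imsetP[x xA ->]; apply/forall_inP=> _ /imsetP[y yA ->].
  by rewrite /= !memE (inj_eq f_inj); apply: (forall_inP (tot x xA)).
have size_fs : size (map f s) == #|f @: A|.
  by rewrite size_map size_tuple card_imset.
apply/existsP; exists (Tuple size_fs); apply/andP; split=> /=.
  have As x : (x \in A) = (x \in tval s) by rewrite -[in LHS]sA inE.
  apply/eqP/setP=> y; rewrite inE.
  by apply/mapP/imsetP=> -[x xs ->]; exists x; rewrite // ?As // -As.
rewrite pairwise_map; apply: sub_pairwise ps => x y /=.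
by rewrite memE.
Qed.

(** Here the colouring is total; its values outside the arcs of [e] play no
    role. *)
Lemma ramsey_gt (t : nat) (n : 'I_t -> nat) (V : finType) (e : rel V)
    (col : V -> V -> 'I_t) :
  tournament [set: V] e ->
  (forall i H,
     ~~ transitive_subtournament [rel x y | e x y && (col x y == i)] (n i) H) ->
  #|V| < ramsey n.
Proof.
move=> te nomono; rewrite /ramsey; case: ex_minnP => N /asboolP RN _.
rewrite ltnNge; apply/negP=> N_le.
(* If N <= #|V|, apply the Ramsey property of N to the tournament pulled back
   along an injection of 'I_N into V. *)
pose f (x : 'I_N) : V := enum_val (widen_ord N_le x).
have f_inj : injective f.
  by move=> x y /enum_val_inj/(congr1 val) /= /val_inj.
pose e0 := [rel x y : 'I_N | e (f x) (f y)].
pose c0 (p : {p : 'I_N * 'I_N | e0 p.1 p.2}) := col (f (val p).1) (f (val p).2).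
have te0 : tournament [set: 'I_N] e0.
  apply/andP; split; apply/forall_inP=> x _; first by rewrite /= (tournament_irr _ te).
  apply/forall_inP=> y _; apply/implyP=> xy.
  by apply: tournament_total te _; rewrite (inj_eq f_inj).
have [i [H [tH mono]]] := RN _ e0 c0 (card_ord N) te0.
case/negP: (nomono i (f @: H.1, [set (f p.1, f p.2) | p in H.2])).
apply: (transitive_subtournament_image f_inj tH) => p pH.
have pe : e0 p.1 p.2 by case/and4P: tH => _ _ /forall_inP/(_ p pH).
by apply/andP; split; [exact: pe | apply/eqP; exact: (mono (exist _ p pe) pH)].
Qed.

Lemma expf_card_pred (F : finFieldType) (x : F) :
  x != 0%R -> (x ^+ #|F|.-1 = 1)%R.
Proof.
move=> x0; apply: (mulIf x0).
by rewrite -exprSr mul1r prednK ?expf_card // ltnW // card_finNzRing_gt1.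
Qed.

Lemma finField_prim_root (F : finFieldType) :
  exists g : F, ((#|F|.-1).-primitive_root g)%R.
Proof.
have n_gt0 : 0 < #|F|.-1 by rewrite -subn1 subn_gt0 card_finNzRing_gt1.
have /hasP[g _ gP] : has (#|F|.-1).-primitive_root%R (enum [set~ 0%R : F]).
  apply: has_prim_root; rewrite ?enum_uniq //.
    apply/allP=> x; rewrite mem_enum !inE unity_rootE => x0.
    by rewrite expf_card_pred.
  by rewrite -cardE cardsC1.
by exists g.
Qed.

Section Cosets.
Variables (F : finFieldType) (g : F) (t j : nat).
Hypothesis t_gt0 : 0 < t.
Hypothesis g_prim : (#|F|.-1.-primitive_root g)%R.
Hypothesis card_F : #|F|.-1 = (2 * t) * (2 * j).+1.

Lemma prim_root_exp (x : F) : x != 0%R -> exists a : nat, x = (g ^+ a)%R.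
Proof.
by move=> /expf_card_pred xn1; have [a ->] := prim_rootP g_prim xn1; exists a.
Qed.

(** The index i < 2t such that x lies in the coset of g ^ i modulo the 2t-th
    powers; it is 0 if x = 0. *)
Definition log (x : F) : nat :=
  if [pick a : 'I_(#|F|.-1) | x == (g ^+ a)%R] is Some a then a %% (2 * t) else 0.

Lemma log_exp a : log (g ^+ a)%R = a %% (2 * t).
Proof.
rewrite /log; case: pickP => [b|/(_ (Ordinal (ltn_pmod a (prim_order_gt0 g_prim))))].
  rewrite (eq_prim_root_expr g_prim) => /eqP ab.
  have d : 2 * t %| #|F|.-1 by rewrite card_F dvdn_mulr.
  by rewrite -(modn_dvdm b d) -(modn_dvdm a d) ab.
by rewrite /= (prim_expr_mod g_prim) eqxx.
Qed.

Lemma log_kth_power (x : F) :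
  x != 0%R -> (x / g ^+ log x)%R \in kth_powers F (2 * t).
Proof.
move=> /prim_root_exp[a ->]; rewrite log_exp.
have g0 : (g != 0)%R by rewrite (prim_root_eq0 g_prim) -lt0n (prim_order_gt0 g_prim).
apply/imsetP; exists (g ^+ (a %/ (2 * t)))%R; first by rewrite !inE expf_neq0.
by rewrite -exprM {1}(divn_eq a (2 * t)) exprD mulfK // expf_neq0.
Qed.

Lemma prim_root_half : (g ^+ (t * (2 * j).+1) = -1)%R.
Proof.
(* The half power is a square root of 1, and differs from 1 because its exponent
   is positive and less than the order of g. *)
set h := t * _; have h2 : ((g ^+ h) ^+ 2 = 1)%R.
  by rewrite -exprM -(prim_expr_order g_prim) card_F /h; congr (_ ^+ _)%R; lia.
move/eqP: h2; rewrite sqrf_eq1 => /orP[|/eqP //].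
rewrite -(prim_order_dvd g_prim) => /dvdn_leq; rewrite card_F /h; lia.
Qed.

Lemma log_opp (x : F) :
  x != 0%R -> log (- x)%R = (log x + t) %% (2 * t).
Proof.
move=> /prim_root_exp[a ->]; rewrite -mulN1r -prim_root_half -exprD !log_exp.
rewrite modnDml (_ : _ + a = j * (2 * t) + (a + t)); last lia.
by rewrite modnMDl.
Qed.

Lemma coset_tournament :
  tournament [set: F] [rel x y | (x != y) && (log (y - x)%R < t)].
Proof.
apply/andP; split; apply/forall_inP=> x _; first by rewrite /= eqxx.
apply/forall_inP=> y _; apply/implyP=> xy /=.
rewrite xy eq_sym xy /= -(opprB y x) log_opp ?subr_eq0 1?eq_sym //.
have : log (y - x)%R < 2 * t.
  by rewrite /log; case: pickP => [a _|_]; rewrite ?ltn_pmod //; lia.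
move: (log _) => a a_lt; have [a_t|t_a] := ltnP a t.
  by rewrite modn_small; lia.
rewrite (_ : a + t = 1 * (2 * t) + (a - t)); last lia.
by rewrite modnMDl modn_small; lia.
Qed.

End Cosets.

Theorem mainTheorem6 (k m q : nat) (F : finFieldType)
  (hk : 2 <= k) (hk2 : ~~ odd k) (hm : 0 < m)
  (hq : #|F| = q) (hmod : q = k + 1 %[mod 2 * k])
  (hK : num_transitive m (@paley F k) = 0) :
  q < ramsey_diag k./2 m.
Proof.
have [g g_prim] := finField_prim_root F.
set t := k./2; have t_gt0 : 0 < t by rewrite /t; lia.
have kE : k = 2 * t by rewrite /t; lia.
have [j card_F] : exists j, #|F|.-1 = (2 * t) * (2 * j).+1.
  exists (q %/ (2 * k)); rewrite hq -kE.
  rewrite {1}(divn_eq q (2 * k)) hmod modn_small; last lia.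
  by rewrite addn1 addnS /=; lia.
(* On arcs the logarithm is already less than t: the reduction modulo t only
   makes the colouring total. *)
pose col x y : 'I_t := Ordinal (ltn_pmod (log g t (y - x)%R) t_gt0).
rewrite -hq; apply: (ramsey_gt (col := col) (coset_tournament t_gt0 g_prim card_F)).
move=> i H; apply/negP=> tH.
have gi0 : ((g ^+ i)^-1 != 0)%R.
  by rewrite invr_eq0 expf_neq0 // (prim_root_eq0 g_prim) -lt0n (prim_order_gt0 g_prim).
pose f (x : F) := (x / g ^+ i)%R.
move/eqP: hK; rewrite cards_eq0 => /eqP/setP.
move/(_ (f @: H.1, [set (f p.1, f p.2) | p in H.2])); rewrite !inE => /negP; apply.
apply: (transitive_subtournament_image _ tH); first exact: mulIf.
move=> p pH; case/and4P: tH => _ _ /forall_inP/(_ p pH) /= + _.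
case/andP=> /andP[xy log_lt] /eqP/(congr1 val) /=; rewrite modn_small // => log_i.
rewrite /paley /f -mulrBl -log_i kE.
by apply: (log_kth_power g_prim card_F); rewrite subr_eq0 eq_sym.
Qed.
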